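(* Let $(G,T)$ be a comb-bipartite graft with spine set $A$ and tooth set $B$, and let $\mathcal{G}(G,T)$ denote its set of factor-components. For $H_1,H_2\in\mathcal{G}(G,T)$ write $H_1\trianglelefteq^\circ H_2$ if $H_1=H_2$ or $E_G[V(H_2)\cap A,\,V(H_1)\cap B]\neq\emptyset$, and write $H_1\trianglelefteq H_2$ if there exist $I_1,\dots,I_k\in\mathcal{G}(G,T)$, $k\ge 1$, with $I_1=H_1$, $I_k=H_2$ and $I_i\trianglelefteq^\circ I_{i+1}$ for every $i\in\{1,\dots,k-1\}$. Then $\trianglelefteq$ is a partial order on $\mathcal{G}(G,T)$.
   Context: Graphs may have loops and parallel edges. For a graph $G$ and $T\subseteq V(G)$, a join of $(G,T)$ is a set $F\subseteq E(G)$ such that, for every vertex $v$, the number of edges of $F$ incident with $v$ is odd iff $v\in T$. The pair $(G,T)$ is a graft if every connected component of $G$ contains an even number of vertices of $T$; a minimum join is a join with the fewest edges, and $\nu(G,T)$ denotes its size. A bipartite graft $(G,T)$ ($G$ bipartite with color classes $A$, $B$) is comb-bipartite with spine set $A$ and tooth set $B$ if $\nu(G,T)=|B|$. An edge is allowed if it belongs to some minimum join. Two vertices are factor-connected if they are equal or joined by a path all of whose edges are allowed; a factor-component is a maximal subgraph $H$ such that any two of its vertices are factor-connected within allowed edges (i.e., a maximal factor-connected subgraft $(H, V(H)\cap T)$, where factor-connectedness of a graft means every two vertices are factor-connected in it). The factor-components are vertex-disjoint and cover $V(G)$. $E_G[X,Y]$ denotes the set of edges with one end in $X$ and the other in $Y$.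 *)

(* Defs.v *)
From mathcomp Require Import all_boot.

Set Implicit Arguments.
Unset Strict Implicit.
Unset Printing Implicit Defensive.

(* Finite undirected multigraphs. The order of the pair [ends e] carries no
   meaning: every notion below is symmetric in it. *)
Record multigraph := Multigraph {
  vert : finType;
  edge : finType;
  ends : edge -> vert * vert
}.

Definition incident (G : multigraph) (e : edge G) (v : vert G) : bool :=
  (v == (ends e).1) || (v == (ends e).2).

Definition edges_between (G : multigraph) (X Y : {set vert G}) :
    {set edge G} :=
  [set e | ((ends e).1 \in X) && ((ends e).2 \in Y)
        || ((ends e).1 \in Y) && ((ends e).2 \in X)].

Definition adj_in (G : multigraph) (F : {set edge G}) : rel (vert G) :=
  [rel u v | [exists e in F, (ends e == (u, v)) || (ends e == (v, u))]].

Definition is_graft (G : multigraph) (T : {set vert G}) : bool :=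
  [forall v, ~~ odd #|[set u in T | connect (adj_in [set: edge G]) v u]|].

Definition is_join (G : multigraph) (T : {set vert G}) (F : {set edge G}) :
    bool :=
  [forall v, odd #|[set e in F | incident e v]| == (v \in T)].

(* The argmin is only meaningful when a join exists, which is the case for
   every graft. *)
Definition nu (G : multigraph) (T : {set vert G}) : nat :=
  #|[arg min_(F < [set: edge G] | is_join T F) #|F|]|.

Definition is_min_join (G : multigraph) (T : {set vert G})
    (F : {set edge G}) : bool :=
  is_join T F && [forall F' : {set edge G}, is_join T F' ==> (#|F| <= #|F'|)].

Definition bipartition (G : multigraph) (A B : {set vert G}) : Prop :=
  [/\ A :|: B = [set: vert G], [disjoint A & B]
    & edges_between A B = [set: edge G]].

Definition comb_bipartite (G : multigraph) (T A B : {set vert G}) : Prop :=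
  [/\ is_graft T, bipartition A B & nu T = #|B|].

Definition allowed (G : multigraph) (T : {set vert G}) : {set edge G} :=
  [set e | [exists F : {set edge G}, is_min_join T F && (e \in F)]].

(* A candidate subgraph is a pair (vertex set, edge set). *)
Definition subgraph (G : multigraph) : finType :=
  ({set vert G} * {set edge G})%type.

Definition is_subgraph (G : multigraph) (H : subgraph G) : bool :=
  [forall e in H.2, ((ends e).1 \in H.1) && ((ends e).2 \in H.1)].

Definition subgraph_le (G : multigraph) (H K : subgraph G) : bool :=
  (H.1 \subset K.1) && (H.2 \subset K.2).

(* Connecting paths stay inside H, but allowed refers to the ambient graft
   (G, T), not to the graft induced on H. *)
Definition factor_connected (G : multigraph) (T : {set vert G})
    (H : subgraph G) : bool :=
  is_subgraph H &&
  [forall u in H.1, forall v in H.1, connect (adj_in (H.2 :&: allowed T)) u v].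

Definition is_factor_component (G : multigraph) (T : {set vert G})
    (H : subgraph G) : bool :=
  factor_connected T H &&
  [forall K : subgraph G,
    (factor_connected T K && subgraph_le H K) ==> (K == H)].

Definition factor_component (G : multigraph) (T : {set vert G}) : finType :=
  {H : subgraph G | is_factor_component T H}.

Definition fc_verts (G : multigraph) (T : {set vert G})
    (H : factor_component T) : {set vert G} := (val H).1.

Definition tri_step (G : multigraph) (T A B : {set vert G}) :
    rel (factor_component T) :=
  [rel H1 H2 | (H1 == H2) ||
    (edges_between (fc_verts H2 :&: A) (fc_verts H1 :&: B) != set0)].

(* The chain I_1, ..., I_k is H1 :: s, so k = (size s).+1. *)
Definition tri_le (G : multigraph) (T A B : {set vert G})
    (H1 H2 : factor_component T) : Prop :=
  exists2 s : seq (factor_component T),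
    path (tri_step A B) H1 s & last H1 s = H2.

(* Main.v *)
(** Write [dist x y] for the least size of a join of [T + x + y] (sum mod 2).
    Swapping a path of the difference of two such joins yields an exchange
    inequality, which shows by induction along paths of allowed edges that
    [dist x y] is at most the size of a minimum join whenever [x] and [y] lie in
    the same factor-component. In a bipartite graph parity makes this strict if
    [x] and [y] have different colours: every factor-component contains, between
    a spine vertex and a tooth vertex, an edge set with more edges inside a given
    minimum join [F0] than outside. A cycle of distinct components for the step
    relation enters each component at a spine and leaves it at a tooth, so these
    edge sets together with the crossing edges form an even set that has at least
    as many edges inside [F0] as outside. Switching [F0] along it gives a minimum
    join through a crossing edge, which would then be allowed. *)

Require Import Defs.
From mathcomp Require Import all_boot zify.

Set Implicit Arguments.
Unset Strict Implicit.
Unset Printing Implicit Defensive.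

(** * Cardinalities of symmetric differences *)

Section SymmetricDifference.

Variable X : finType.
Implicit Types A B C : {set X}.

Definition symdiff A B : {set X} := [set x | (x \in A) (+) (x \in B)].

Lemma card_symdiff A B : #|symdiff A B| + (#|A :&: B|).*2 = #|A| + #|B|.
Proof.
have -> : symdiff A B = (A :\: B) :|: (B :\: A).
  by apply/setP=> x; rewrite !inE; case: (x \in A); case: (x \in B).
rewrite cardsU; have -> : (A :\: B) :&: (B :\: A) = set0.
  by apply/setP=> x; rewrite !inE; case: (x \in A); case: (x \in B).
have := cardsID B A; have := cardsID A B; rewrite (setIC B A) cards0; lia.
Qed.

Lemma odd_card_symdiff A B : odd #|symdiff A B| = odd #|A| (+) odd #|B|.
Proof. by rewrite -oddD -card_symdiff oddD odd_double addbF. Qed.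

Lemma card_symdiff_le A B : #|symdiff A B| <= #|A| + #|B|.
Proof. by rewrite -card_symdiff leq_addr. Qed.

Lemma card_symdiff1 A x :
  #|symdiff A [set x]| = if x \in A then #|A|.-1 else #|A|.+1.
Proof.
have := card_symdiff A [set x]; rewrite cards1.
case: ifP => xA.
  have -> : A :&: [set x] = [set x] by apply/setIidPr; rewrite sub1set.
  rewrite cards1; lia.
have -> : A :&: [set x] = set0.
  by apply/setP=> y; rewrite !inE; case: eqP => [->|_]; rewrite ?xA ?andbF.
rewrite cards0; lia.
Qed.

(** Each element of [C] lies in exactly one of [A] and [B], so toggling [C] in both only moves it
    from one to the other. *)
Lemma card_symdiff_exchange A B C : C \subset symdiff A B ->
  #|symdiff A C| + #|symdiff B C| = #|A| + #|B|.
Proof.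
move=> sC; have := card_symdiff A C; have := card_symdiff B C.
suff : #|C| = #|A :&: C| + #|B :&: C| by lia.
rewrite -(cardsID A C) (setIC C A); congr (_ + _); apply: eq_card => x.
rewrite !inE; have := subsetP sC x; rewrite !inE.
by case: (x \in A); case: (x \in B); case: (x \in C) => // /(_ isT).
Qed.

End SymmetricDifference.

(** * Boundaries of edge sets modulo 2 *)

Section Boundary.

Variable G : multigraph.
Implicit Types (F P Q : {set edge G}) (u v x y z : vert G) (e : edge G).

(** The boundary map over the field with two elements: joins of [T] are the sets with boundary [T],
    and [bd] turns symmetric differences into sums. *)
Definition bd F v : bool := odd #|[set e in F | incident e v]|.

Lemma bd_symdiff F P v : bd (symdiff F P) v = bd F v (+) bd P v.
Proof.
rewrite /bd -odd_card_symdiff; congr (odd _); apply: eq_card => e.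
by rewrite !inE; case: (incident e v); rewrite ?andbT ?andbF.
Qed.

Lemma bd0 v : bd set0 v = false.
Proof.
rewrite /bd; have -> : [set e in set0 | incident e v] = set0.
  by apply/setP=> e; rewrite !inE.
by rewrite cards0.
Qed.

Definition links e u v := (ends e == (u, v)) || (ends e == (v, u)).

Lemma linksC e u v : links e u v = links e v u.
Proof. by rewrite /links orbC. Qed.

Lemma links_incident e u v w : links e u v ->
  incident e w = (w == u) || (w == v).
Proof. by rewrite /incident => /orP[]/eqP-> //=; rewrite orbC. Qed.

Lemma incident_links e v : incident e v -> exists u, links e v u.
Proof.
rewrite /incident /links; case: (ends e) => a b /orP[]/eqP->.
  by exists b; rewrite eqxx.
by exists a; rewrite eqxx orbT.
Qed.

Definition loopless := forall e, (ends e).1 != (ends e).2.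

Hypothesis G_loopless : loopless.

Lemma links_neq e u v : links e u v -> u != v.
Proof. by have := G_loopless e => /[swap] /orP[]/eqP-> //=; rewrite eq_sym. Qed.

Lemma bd1 e u v w : links e u v -> bd [set e] w = (w == u) (+) (w == v).
Proof.
move=> euv; have uv := links_neq euv.
have -> : (w == u) (+) (w == v) = incident e w.
  rewrite (links_incident w euv); case: eqP => // ->; by rewrite (negPf uv).
rewrite /bd; case He: (incident e w).
  have -> : [set e0 in [set e] | incident e0 w] = [set e].
    by apply/setP=> e'; rewrite !inE; case: eqP => // ->; rewrite He.
  by rewrite cards1.
have -> : [set e0 in [set e] | incident e0 w] = set0.
  by apply/setP=> e'; rewrite !inE; case: eqP => // ->; rewrite He.
by rewrite cards0.
Qed.

(** A trail is followed from [x], deleting each edge used. If the new end [x'] is odd in [F], the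
    trail stops there; otherwise [x'] is odd once [e] is deleted, and the induction continues from
    it. The final vertex differs from [x] because deleting [e] makes [x] even. *)
Lemma odd_subset_path F x : bd F x ->
  exists Q y, [/\ Q \subset F, bd F y, y != x
    & forall v, bd Q v = (v == x) (+) (v == y)].
Proof.
have [n] := ubnP #|F|; elim: n F x => // n IH F x /ltnSE leF Fx.
have [e] : exists e, e \in [set e in F | incident e x].
  by apply/set0Pn; apply: contraTneq Fx => E; rewrite /bd E cards0.
rewrite inE => /andP[eF /incident_links[x' exx']].
have neq := links_neq exx'.
have bF' v : bd (F :\ e) v = bd F v (+) ((v == x) (+) (v == x')).
  have -> : F :\ e = symdiff F [set e].
    by apply/setP=> e'; rewrite !inE; case: eqP => [->|_]; rewrite ?eF ?addbF.
  by rewrite bd_symdiff (bd1 _ exx').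
case Fx' : (bd F x').
  exists [set e], x'; split=> //; rewrite ?sub1set // 1?eq_sym //.
  by move=> v; rewrite (bd1 _ exx').
have := IH (F :\ e) x'; rewrite bF' Fx' eqxx eq_sym (negPf neq) /=.
case=> //; first by move: leF; rewrite (cardsD1 e F) eF.
move=> Q [y [sQ Fy yx' bQ]].
have yx : y != x.
  by apply: contraTneq Fy => ->; rewrite bF' eqxx (negPf neq) Fx.
exists (symdiff Q [set e]), y; split=> //.
- apply/subsetP=> e'; rewrite !inE; case: eqP => [->|_] //.
  by rewrite addbF => /(subsetP sQ); rewrite !inE => /andP[].
- by move: Fy; rewrite bF' (negPf yx) (negPf yx') /= addbF.
move=> v; rewrite bd_symdiff bQ (bd1 _ exx').
by case: (v == x); case: (v == x'); case: (v == y).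
Qed.

(** Every edge has exactly one end in [B], so adding an edge flips both parities. *)
Lemma odd_card_bipartite (B : {set vert G}) F :
    (forall e, ((ends e).1 \in B) (+) ((ends e).2 \in B)) ->
  odd #|F| = odd #|[set v in B | bd F v]|.
Proof.
move=> hB; have [n] := ubnP #|F|; elim: n F => // n IH F /ltnSE leF.
have [->|[e eF]] := set_0Vmem F.
  have -> : [set v in B | bd set0 v] = set0.
    by apply/setP=> v; rewrite !inE bd0 andbF.
  by rewrite !cards0.
have -> : F = symdiff (F :\ e) [set e].
  by apply/setP=> e'; rewrite !inE; case: eqP => [->|_]; rewrite ?eF ?addbF.
set F' := F :\ e.
have -> : [set v in B | bd (symdiff F' [set e]) v]
        = symdiff [set v in B | bd F' v] [set v in B | bd [set e] v].
  by apply/setP=> v; rewrite !inE bd_symdiff; case: (v \in B).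
rewrite !odd_card_symdiff -IH; last by move: leF; rewrite (cardsD1 e F) eF.
congr (_ (+) _); rewrite cards1.
have el : links e (ends e).1 (ends e).2 by rewrite /links -surjective_pairing eqxx.
have [w wP] : exists w, forall v, (v \in B) && bd [set e] v = (v == w).
  have := hB e; have ne := links_neq el.
  case b1: ((ends e).1 \in B); case b2: ((ends e).2 \in B) => //= _.
    exists (ends e).1 => v; rewrite (bd1 _ el).
    have [->|_] := eqVneq v (ends e).1; first by rewrite b1 (negPf ne).
    by case: eqP => [->|_]; rewrite ?b2 ?andbF.
  exists (ends e).2 => v; rewrite (bd1 _ el).
  have [->|_] := eqVneq v (ends e).2; first by rewrite b2 eq_sym (negPf ne).
  by case: eqP => [->|_]; rewrite ?b1 ?andbF.
have -> : [set v in B | bd [set e] v] = [set w] by apply/setP=> v; rewrite !inE wP.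
by rewrite cards1.
Qed.

End Boundary.

(** * Distances defined by shifted joins of allowed edges *)

Section Allowed.

Variables (G : multigraph) (T : {set vert G}) (F0 : {set edge G}).
Hypothesis G_loopless : loopless G.
Hypothesis F0_min : is_min_join T F0.
Implicit Types (F P Q : {set edge G}) (u v x y z : vert G) (e : edge G).

Lemma is_joinP F : reflect (forall v, bd F v = (v \in T)) (is_join T F).
Proof. by apply: (iffP forallP) => h v; apply/eqP/h. Qed.

Lemma min_join_le F : (forall v, bd F v = (v \in T)) -> #|F0| <= #|F|.
Proof.
move/is_joinP=> FT; case/andP: F0_min => _ /forallP/(_ F).
by rewrite FT.
Qed.

Lemma min_join_bd v : bd F0 v = (v \in T).
Proof. by case/andP: F0_min => /is_joinP. Qed.

Lemma card_min_join F : is_min_join T F -> #|F| = #|F0|.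
Proof.
case/andP=> /is_joinP FT /forallP/(_ F0) Fle; apply/eqP.
rewrite eqn_leq min_join_le // andbT; apply: (implyP Fle).
by case/andP: F0_min.
Qed.

Lemma min_join_allowed F : is_min_join T F -> F \subset allowed T.
Proof.
by move=> Fm; apply/subsetP=> e eF; rewrite inE; apply/existsP; exists F; rewrite Fm.
Qed.

Definition shifted_join x y F :=
  (F \subset allowed T) &&
  [forall v, bd F v == (v \in T) (+) ((v == x) (+) (v == y))].

Lemma shifted_joinP x y F :
  reflect (F \subset allowed T /\
           forall v, bd F v = (v \in T) (+) ((v == x) (+) (v == y)))
          (shifted_join x y F).
Proof.
apply: (iffP andP) => -[sF h]; split=> //.
  by move=> v; apply/eqP/(forallP h).
by apply/forallP=> v; apply/eqP.
Qed.

Lemma dist_exists x y : exists n,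
  [exists F, shifted_join x y F && (#|F| == n)] || (n == #|edge G|.+1).
Proof. by exists #|edge G|.+1; rewrite eqxx orbT. Qed.

(* Takes the value [#|edge G|.+1] when there is no such join. *)
Definition dist x y : nat := ex_minn (dist_exists x y).

Lemma dist_le x y F : shifted_join x y F -> dist x y <= #|F|.
Proof.
move=> Fxy; rewrite /dist; case: ex_minnP => n _; apply.
by apply/orP; left; apply/existsP; exists F; rewrite Fxy eqxx.
Qed.

(** The bound excludes the default value, which exceeds the size of every edge set. *)
Lemma dist_attained x y : dist x y <= #|F0| ->
  exists2 F, shifted_join x y F & #|F| = dist x y.
Proof.
rewrite /dist; case: ex_minnP => n /orP[/existsP[F /andP[Fxy /eqP <-]]|/eqP->] _ le.
  by exists F.
by have := max_card F0; move: le; clear; lia.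
Qed.

Lemma symdiff_allowed F P : F \subset allowed T -> P \subset allowed T ->
  symdiff F P \subset allowed T.
Proof.
move=> /subsetP sF /subsetP sP; apply/subsetP=> e; rewrite [_ \in symdiff _ _]inE.
by case eF: (e \in F); [move=> _; apply: sF | move/sP].
Qed.

Lemma shifted_join_toggle x u v e F : e \in allowed T -> links e u v ->
  shifted_join x u F -> shifted_join x v (symdiff F [set e]).
Proof.
move=> eA euv /shifted_joinP[sF bF]; apply/shifted_joinP; split.
  by apply: symdiff_allowed => //; rewrite sub1set.
move=> w; rewrite bd_symdiff (bd1 _ _ euv) // bF.
by case: (w \in T); case: (w == x); case: (w == u); case: (w == v).
Qed.

Lemma shifted_join_sym x y F : shifted_join x y F = shifted_join y x F.
Proof.
rewrite /shifted_join; congr (_ && _).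
by apply: eq_forallb => v; rewrite (addbC (v == x)).
Qed.

Lemma dist_step x u v e : e \in allowed T -> links e u v ->
  dist x u <= #|F0| -> dist x v <= (dist x u).+1.
Proof.
move=> eA euv /dist_attained[F Fxu <-].
apply: leq_trans (dist_le (shifted_join_toggle eA euv Fxu)) _.
by have := card_symdiff1 F e; case: ifP; lia.
Qed.

Lemma dist_sym x y : dist x y = dist y x.
Proof.
rewrite /dist; apply: eq_ex_minn => n; congr (_ || _).
by apply: eq_existsb => F; rewrite shifted_join_sym.
Qed.

(** Deleting [e] from a minimum join through it realizes the shift with one edge fewer. *)
Lemma dist_allowed e u v : e \in allowed T -> links e u v -> dist u v < #|F0|.
Proof.
move=> eA euv; have := eA; rewrite inE => /existsP[F /andP[Fm eF]].
have F_pos : 0 < #|F| by rewrite (cardD1 e) eF.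
rewrite -(card_min_join Fm).
have FS : shifted_join u u F.
  apply/shifted_joinP; split; first exact: min_join_allowed.
  by move=> w; case/andP: Fm => /is_joinP-> _; rewrite addbb addbF.
have := dist_le (shifted_join_toggle eA euv FS).
by rewrite card_symdiff1 eF; lia.
Qed.

(* For optimal joins F1, F2 of the shifts (x, u) and (v, z), either toggle e in
   both, or swap between them a path of their difference that starts at x; the
   three outcomes are distinguished by the other end of this path. *)
Lemma dist_exchange x z u v e : e \in allowed T -> links e u v ->
    dist x u <= #|F0| -> dist v z <= #|F0| ->
  dist x z + #|F0| <= dist x u + dist v z + 1 \/
  dist x v + dist u z <= dist x u + dist v z.
Proof.
move=> eA euv /dist_attained[F1 F1S <-] /dist_attained[F2 F2S <-].
have F1t := dist_le (shifted_join_toggle eA euv F1S).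
have F2t : dist u z <= #|symdiff F2 [set e]|.
  rewrite dist_sym; apply: dist_le; apply: (@shifted_join_toggle z v u) => //.
    by rewrite linksC.
  by rewrite shifted_join_sym.
have := card_symdiff1 F1 e; have := card_symdiff1 F2 e.
have pos F : e \in F -> 0 < #|F| by move=> eF; rewrite (cardD1 e) eF.
(* If [e] lies in [F1] or [F2], toggling it in both does not increase the total size, which is the
   second alternative. Only the case of [e] in neither set remains. *)
case: ifPn => [/pos|] e2; case: ifPn => [/pos|] e1; try (by right; lia).
have /shifted_joinP[s1 b1] := F1S; have /shifted_joinP[s2 b2] := F2S.
move=> c2 c1.
pose D := symdiff F1 F2.
have bD w : bd D w = ((w == x) (+) (w == u)) (+) ((w == v) (+) (w == z)).
  rewrite bd_symdiff b1 b2.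
  by case: (w \in T); case: (w == x); case: (w == u); case: (w == v); case: (w == z).
have uv := links_neq G_loopless euv.
have sD := symdiff_allowed s1 s2.
(* Q is empty when x cancels against one of u, v, z. *)
have [Q [y [sQ yP bQ]]] : exists Q y, [/\ Q \subset D,
   [|| y == u, y == v | y == z] & forall w, bd Q w = (w == x) (+) (w == y)].
  case Dx: (bd D x).
    have [Q [y [sQ Dy yx bQ]]] := odd_subset_path G_loopless Dx.
    exists Q, y; split=> //; move: Dy; rewrite bD (negPf yx).
    by case: (y == u); case: (y == v); case: (y == z).
  exists set0, x; split; first exact: sub0set.
    by move: Dx; rewrite bD eqxx; case: (x == u); case: (x == v); case: (x == z).
  by move=> w; rewrite bd0 addbb.
have cQ := card_symdiff_exchange sQ.
have sQA : Q \subset allowed T := subset_trans sQ sD.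
have eQ : e \notin Q.
  by apply/negP=> /(subsetP sQ); rewrite inE (negPf e1) (negPf e2).
have sQ1 := symdiff_allowed s1 sQA; have sQ2 := symdiff_allowed s2 sQA.
(* For [y = u] the swap makes [F1] a join of [T], and for [y = v] it does so after toggling [e];
   such a join has at least [#|F0|] edges. The single toggle of [e], in one set or the other,
   accounts for the [+ 1]. For [y = z] the swap alone re-pairs the ends. *)
case/or3P: yP => /eqP yE; subst y.
- left.
  have : #|F0| <= #|symdiff F1 Q|.
    by apply: min_join_le => w; rewrite bd_symdiff b1 bQ -addbA addbb addbF.
  have : dist x z <= #|symdiff (symdiff F2 Q) [set e]|.
    apply: dist_le; apply/shifted_joinP; split.
      by apply: symdiff_allowed; rewrite ?sub1set.
    move=> w; rewrite !bd_symdiff b2 bQ (bd1 _ _ euv) //.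
    by case: (w \in T); case: (w == x); case: (w == u); case: (w == v); case: (w == z).
  by have := card_symdiff_le (symdiff F2 Q) [set e]; rewrite cards1; move: cQ; clear; lia.
- left.
  have : #|F0| <= #|symdiff (symdiff F1 Q) [set e]|.
    apply: min_join_le => w; rewrite !bd_symdiff b1 bQ (bd1 _ _ euv) //.
    by case: (w \in T); case: (w == x); case: (w == u); case: (w == v).
  have : dist x z <= #|symdiff F2 Q|.
    apply: dist_le; apply/shifted_joinP; split=> // w; rewrite bd_symdiff b2 bQ.
    by case: (w \in T); case: (w == x); case: (w == v); case: (w == z).
  by have := card_symdiff_le (symdiff F1 Q) [set e]; rewrite cards1; move: cQ; clear; lia.
right.
have : dist x v <= #|symdiff F2 Q|.
  apply: dist_le; apply/shifted_joinP; split=> // w; rewrite bd_symdiff b2 bQ.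
  by case: (w \in T); case: (w == x); case: (w == v); case: (w == z).
have : dist u z <= #|symdiff F1 Q|.
  apply: dist_le; apply/shifted_joinP; split=> // w; rewrite bd_symdiff b1 bQ.
  by case: (w \in T); case: (w == x); case: (w == u); case: (w == z).
by move: cQ; clear; lia.
Qed.

Lemma dist_path x p : path (adj_in (allowed T)) x p -> dist x (last x p) <= #|F0|.
Proof.
(* For a shortest counterexample with vertices w i, the exchange inequality
   forces dist x (w i) - dist (w i) z to be nonincreasing in i, although it
   goes from negative at x to positive at z. *)
have [n] := ubnP (size p); elim: n x p => // n IH x p /ltnSE le_pn xp.
have [p0|p_pos] := posnP (size p).
  rewrite (size0nil p0) /=; apply: dist_le; apply/shifted_joinP; split.
    exact: min_join_allowed.
  by move=> v; rewrite min_join_bd addbb addbF.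
set z := last x p; rewrite leqNgt; apply/negP=> gt_xz.
pose w i := nth x (x :: p) i.
have wE i : i < size p -> exists2 e, e \in allowed T & links e (w i) (w i.+1).
  by move=> /((pathP x xp) i) /existsP[e /andP[eA]]; exists e.
have w0 : w 0 = x by [].
have wz : w (size p) = z by rewrite /w /z (last_nth x).
have f_le i : i < size p -> dist x (w i) <= #|F0|.
  move=> lt_ip; have := IH x (take i p).
  have -> : last x (take i p) = w i.
    rewrite (last_nth x) size_takel 1?ltnW // /w.
    by rewrite -[x :: take i p]/(take i.+1 (x :: p)) nth_take.
  by apply; rewrite ?take_path // size_takel; lia.
have g_le i : 0 < i -> i <= size p -> dist (w i) z <= #|F0|.
  case: i => // i _ lt_ip; have := IH (w i.+1) (drop i.+1 p).
  have dE : drop i p = w i.+1 :: drop i.+1 p by rewrite (drop_nth x) // /w.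
  have -> : last (w i.+1) (drop i.+1 p) = z.
    by rewrite /z -[in RHS](cat_take_drop i p) last_cat dE.
  apply; first by rewrite size_drop; lia.
  by move: xp; rewrite -{1}(cat_take_drop i p) cat_path dE => /andP[_ /andP[]].
have f1 : dist x (w 1) < #|F0|.
  by have [e eA el] := wE 0 p_pos; apply: dist_allowed eA el.
have gn : dist (w (size p).-1) z < #|F0|.
  have [|e eA] := wE (size p).-1; first by rewrite prednK.
  by rewrite prednK // wz; apply: dist_allowed.
have xz_le : dist x z <= #|F0|.+1.
  have [|e eA] := wE (size p).-1; first by rewrite prednK.
  rewrite prednK // wz => el; have fl := f_le (size p).-1 ltac:(lia).
  by have := dist_step eA el fl; lia.
have [/existsP[i lt_i]|/existsPn all_ge] := boolP [exists i : 'I_(size p),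
    dist x (w i) + dist (w i.+1) z < dist x (w i.+1) + dist (w i) z].
  have [e eA el] := wE i (ltn_ord i).
  have fi := f_le i (ltn_ord i); have gi := g_le i.+1 isT (ltn_ord i).
  have [] := dist_exchange eA el fi gi; last by lia.
  (* Since [dist x z] exceeds [#|F0|], the first alternative leaves no slack in the two bounds. By
     [lt_i] the other two distances then sum to more than twice [#|F0|]. *)
  move=> le; have [fE gE] : dist x (w i) = #|F0| /\ dist (w i.+1) z = #|F0| by lia.
  have f' : i.+1 < size p -> dist x (w i.+1) <= #|F0| by exact: f_le.
  have g' : 0 < i -> dist (w i) z <= #|F0| by move=> /g_le; apply; apply: ltnW.
  (* At interior indices this contradicts the induction bounds. At either end of a longer path one
     of the distances is [dist x z], whose excess of at most one is offset by [f1] or [gn]; on a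
     one-edge path [f1] itself contradicts [gt_xz]. *)
  have [i0|i_pos] := posnP i; have [iS|iS] := ltnP i.+1 (size p).
  - by move: lt_i f1; rewrite i0 w0 in fE gE *; lia.
  - have E : i.+1 = size p by have := ltn_ord i; lia.
    by move: gt_xz f1; rewrite -wz -E i0; lia.
  - by have := f' iS; have := g' i_pos; lia.
  have E : i.+1 = size p by have := ltn_ord i; lia.
  have Ei : w i = w (size p).-1 by congr w; move: E; clear; lia.
  by move: lt_i fE gE gn xz_le; rewrite E Ei wz; clear; lia.
have mono i : i <= size p -> dist x (w i) + dist x z <= dist x x + dist (w i) z.
  elim: i => [|i IHi] lt_ip; first by rewrite w0 addnC.
  have := all_ge (Ordinal lt_ip); have := IHi (ltnW lt_ip); rewrite -leqNgt /=; lia.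
have := mono _ (leqnn _); rewrite wz.
have := f_le 0 p_pos; have := g_le _ p_pos (leqnn _); rewrite wz w0; lia.
Qed.

End Allowed.

(** * Factor-components as classes of connectivity by allowed edges *)

Section FactorComponents.

Variables (G : multigraph) (T : {set vert G}).
Implicit Types (u v x y z : vert G) (e : edge G) (H K : factor_component T).

Lemma adj_in_connect_sym (F : {set edge G}) : connect_sym (adj_in F).
Proof.
apply: sym_connect_sym => u v; rewrite /adj_in /=.
by apply: eq_existsb => e; rewrite [(_ == (u, v)) || _]orbC.
Qed.

Definition factor_class x : {set vert G} :=
  [set y | connect (adj_in (allowed T)) x y].

(** All edges inside the class are kept, allowed or not, because a factor-component is maximal in
    its edges too. *)
Definition class_subgraph x : subgraph G :=
  (factor_class x,
   [set e | ((ends e).1 \in factor_class x) && ((ends e).2 \in factor_class x)]).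

Lemma class_subgraph_connected x : factor_connected T (class_subgraph x).
Proof.
apply/andP; split; first by apply/forall_inP=> e; rewrite inE.
apply/forall_inP=> u ux; apply/forall_inP=> v vx; rewrite !inE in ux vx.
have /connectP[p up ->] : connect (adj_in (allowed T)) u v.
  by apply: connect_trans vx; rewrite adj_in_connect_sym.
elim: p u ux up {vx} => [|w p IH] u ux /=; first by rewrite connect0.
case/andP=> uw wp.
have wx : connect (adj_in (allowed T)) x w := connect_trans ux (connect1 uw).
apply: connect_trans (IH _ wx wp); apply: connect1.
case/existsP: uw => e /andP[eA euw]; apply/existsP; exists e.
rewrite euw andbT inE eA andbT !inE.
by case/orP: euw => /eqP-> /=; rewrite ux wx.
Qed.

(** Connecting paths in [H] use allowed edges, so [H] lies below the factor-connected subgraph of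
    the class of [x]; maximality gives equality. *)
Lemma factor_componentE H x : x \in fc_verts H -> val H = class_subgraph x.
Proof.
move=> xH; case/andP: (valP H) => /andP[/forall_inP subH /forall_inP conH].
move=> /forallP/(_ (class_subgraph x)); rewrite class_subgraph_connected /=.
have clH y : y \in (val H).1 -> y \in factor_class x.
  move=> yH; rewrite inE; have /forall_inP/(_ y yH) := conH x xH.
  apply: connect_sub => u v /existsP[e /andP[+ euv]].
  rewrite inE => /andP[_ eA]; apply: connect1; apply/existsP; exists e.
  by rewrite eA.
suff -> : subgraph_le (val H) (class_subgraph x) by move/eqP->.
apply/andP; split; first by apply/subsetP.
apply/subsetP=> e /subH /andP[e1 e2].
by rewrite [e \in _]inE !clH.
Qed.

Lemma factor_component_eq H K x : x \in fc_verts H -> x \in fc_verts K -> H = K.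
Proof.
move=> xH xK; apply: val_inj.
by rewrite (factor_componentE xH) (factor_componentE xK).
Qed.

Lemma factor_component_connect H x y : x \in fc_verts H ->
  (y \in fc_verts H) = connect (adj_in (allowed T)) x y.
Proof. by move=> xH; rewrite /fc_verts (factor_componentE xH) inE. Qed.

Lemma allowed_component H e x y : e \in allowed T -> links e x y ->
  (x \in fc_verts H) = (y \in fc_verts H).
Proof.
move=> eA; wlog suff h : x y / links e x y -> x \in fc_verts H -> y \in fc_verts H.
  by move=> exy; apply/idP/idP; apply: h => //; rewrite linksC.
move=> exy xH; rewrite (factor_component_connect _ xH); apply: connect1.
by apply/existsP; exists e; rewrite eA.
Qed.

End FactorComponents.

(** * Surplus of minimum-join edges inside one component of a bipartite graft *)

Section BipartiteGrafts.

Variables (G : multigraph) (T A B : {set vert G}).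
Hypothesis AB : bipartition A B.
Implicit Types (u v x y z : vert G) (e : edge G) (H K : factor_component T).
Implicit Types (F P Q C : {set edge G}).

Lemma bipartition_disjoint v : v \in A -> v \in B -> False.
Proof. by case: AB => _ /pred0P/(_ v) /= dAB _ vA vB; rewrite vA vB in dAB. Qed.

Lemma bipartition_edge e : ((ends e).1 \in A) && ((ends e).2 \in B) ||
  ((ends e).1 \in B) && ((ends e).2 \in A).
Proof. by case: AB => _ _ /setP/(_ e); rewrite !inE. Qed.

Lemma bipartition_loopless : loopless G.
Proof.
move=> e; apply/negP=> /eqP E; have := bipartition_edge e; rewrite E.
by case/orP=> /andP[]; [|move=> /[swap]]; apply: bipartition_disjoint.
Qed.

Lemma bipartition_addb e : ((ends e).1 \in B) (+) ((ends e).2 \in B).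
Proof.
case/orP: (bipartition_edge e) => /andP[h1 h2].
  by rewrite h2 addbT; apply/negP/bipartition_disjoint.
by rewrite h1 addTb; apply/negP/bipartition_disjoint.
Qed.

Section MinJoin.

Variable F0 : {set edge G}.
Hypothesis F0_min : is_min_join T F0.

(** Switching [F0] along [C] gives another join, which cannot be smaller. *)
Lemma bd0_balanced C : (forall v, bd C v = false) -> #|C :&: F0| <= #|C :\: F0|.
Proof.
move=> C0; have /(min_join_le F0_min) : forall v, bd (symdiff F0 C) v = (v \in T).
  by move=> v; rewrite bd_symdiff C0 addbF (min_join_bd F0_min).
have := card_symdiff F0 C; have := cardsID F0 C; rewrite (setIC F0 C); lia.
Qed.

(** The difference [D] of [F0] and an optimal shifted join has at least as many edges inside [F0] as
    outside. Its part away from [H] has empty boundary, hence no surplus inside [F0], so the part in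
    [H] has no deficit. That part has odd size, since [b] is its only odd vertex in [B]; hence the
    inequality is strict. *)
Lemma component_path H a b : a \in fc_verts H -> b \in fc_verts H ->
    a \in A -> b \in B ->
  exists P, [/\ forall v, bd P v = (v == a) (+) (v == b),
    P \subset allowed T, forall e, e \in P -> (ends e).1 \in fc_verts H
    & #|P :\: F0| < #|P :&: F0|].
Proof.
move=> aH bH aA bB.
have: b \in fc_verts H by []; rewrite (factor_component_connect _ aH).
case/connectP=> p ap bE.
have := dist_path bipartition_loopless F0_min ap; rewrite -bE => dle.
have [F /shifted_joinP[sF bF] cF] := dist_attained dle.
have cFle : #|F| <= #|F0| by rewrite cF.
(* Testing one end suffices: both ends of an allowed edge lie in the same component. *)
pose D := symdiff F0 F; pose EH := [set e | (ends e).1 \in fc_verts H].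
have sD : D \subset allowed T.
  by apply: symdiff_allowed sF; apply: min_join_allowed.
have bD v : bd D v = (v == a) (+) (v == b).
  by rewrite bd_symdiff (min_join_bd F0_min) bF addKb.
have bP v : bd (D :&: EH) v = (v == a) (+) (v == b).
  rewrite -bD; case vH: (v \in fc_verts H).
    rewrite /bd; congr (odd _); apply: eq_card => e; rewrite !inE -!andbA.
    rewrite -/D; case eD: (_ (+) _) => //=.
    case ev: (incident e v); rewrite ?andbF // andbT.
    have eA : e \in allowed T by apply: (subsetP sD); rewrite inE.
    case/orP: ev => /eqP vE; rewrite -?vE //.
    rewrite (@allowed_component _ _ H e _ v) // /links vE.
    by rewrite -surjective_pairing eqxx.
  have -> : bd (D :&: EH) v = false.
    rewrite /bd; set S := [set _ in _ | _]; suff -> : S = set0 by rewrite cards0.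
    apply/setP=> e; rewrite in_set0 inE; apply/negP=> /andP[/setIP[eD]].
    rewrite inE => eH ev; have eA := subsetP sD e eD.
    suff : v \in fc_verts H by rewrite vH.
    case/orP: ev => /eqP vE; rewrite vE //.
    rewrite -(@allowed_component _ _ H e (ends e).1) // /links.
    by rewrite -surjective_pairing eqxx.
  rewrite bD; case: eqP => [va|_]; first by rewrite va aH in vH.
  by case: eqP => [vb|_] //; rewrite vb bH in vH.
have odd_P : odd #|D :&: EH|.
  rewrite (odd_card_bipartite bipartition_loopless _ bipartition_addb).
  suff -> : [set v in B | bd (D :&: EH) v] = [set b] by rewrite cards1.
  apply/setP=> v; rewrite !inE bP.
  have [->|_] := eqVneq v a; last by case: eqP => [->|]; rewrite ?bB ?andbF.
  have aB : a \in B = false by apply/negP/bipartition_disjoint.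
  by rewrite aB; case: eqP => // ab; rewrite ab bB in aB.
have rest : #|(D :\: EH) :&: F0| <= #|(D :\: EH) :\: F0|.
  apply: bd0_balanced => v.
  have -> : D :\: EH = symdiff D (D :&: EH).
    by apply/setP=> e; rewrite in_setD !in_set; case: (_ (+) _); case: (_ \in _).
  by rewrite bd_symdiff bD bP addbb.
exists (D :&: EH); split=> //.
- exact: subset_trans (subsetIl _ _) sD.
- by move=> e /setIP[_]; rewrite inE.
have eD0 : #|D :\: F0| <= #|D :&: F0|.
  have := card_symdiff F0 F.
  have := cardsID F0 F; have := cardsID F F0; rewrite (setIC F F0).
  have -> : D :\: F0 = F :\: F0.
    by apply/setP=> e; rewrite !inE; case: (e \in F0).
  have -> : D :&: F0 = F0 :\: F.
    by apply/setP=> e; rewrite !inE; case: (e \in F0); case: (e \in F).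
  move: cFle; clear; lia.
have c1 := cardsID EH (D :&: F0); have c2 := cardsID EH (D :\: F0).
have c3 := cardsID F0 (D :&: EH).
rewrite -setIA (setIC F0) setIA in c1.
have e1 : D :&: F0 :\: EH = (D :\: EH) :&: F0.
  apply/setP=> e; rewrite !in_setI !in_setD !in_setI.
  by case: (_ \in EH); case: (_ \in D); case: (_ \in F0).
have e2 : (D :\: F0) :&: EH = (D :&: EH) :\: F0.
  apply/setP=> e; rewrite !in_setI !in_setD !in_setI.
  by case: (_ \in EH); case: (_ \in D); case: (_ \in F0).
have e3 : D :\: F0 :\: EH = (D :\: EH) :\: F0.
  apply/setP=> e; rewrite !in_setD.
  by case: (_ \in EH); case: (_ \in D); case: (_ \in F0).
rewrite e1 in c1; rewrite e2 e3 in c2.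
move: c1 c2 c3 eD0 rest odd_P; clear; lia.
Qed.

(** * Chains of distinct components and acyclicity *)

Definition strict_step : rel (factor_component T) :=
  [rel H K | (H != K) && tri_step A B H K].

(** The crossing edge is not allowed, since an allowed edge would put both ends in one component. *)
Lemma strict_stepP H K : strict_step H K -> exists e b a,
  [/\ links e b a, e \notin allowed T, b \in fc_verts H :&: B
    & a \in fc_verts K :&: A].
Proof.
case/andP=> /= neHK /orP[|/set0Pn[e]]; first by rewrite (negPf neHK).
rewrite inE => eP.
have [b [a [eba bH aK]]] : exists b a,
    [/\ links e b a, b \in fc_verts H :&: B & a \in fc_verts K :&: A].
  by case/orP: eP => /andP[h1 h2];
    [exists (ends e).2, (ends e).1 | exists (ends e).1, (ends e).2];
    rewrite /links -surjective_pairing eqxx ?orbT.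
exists e, b, a; split=> //; apply/negP=> eA.
move: bH aK; rewrite !inE => /andP[bH _] /andP[aK _].
move: bH; rewrite (allowed_component _ eA eba) => aH.
by case/eqP: neHK; apply: factor_component_eq aH aK.
Qed.

(** Each component contributes a surplus of at least one edge inside [F0] and each crossing edge
    costs one; there is one crossing edge fewer than components. Locating the allowed edges of [C]
    serves the induction: it keeps the piece in a new component disjoint from the rest. *)
Lemma chain_path K p a b : path strict_step K p -> uniq (K :: p) ->
    a \in fc_verts K :&: A -> b \in fc_verts (last K p) :&: B ->
  exists C, [/\ forall v, bd C v = (v == a) (+) (v == b),
    forall e, e \in C -> e \in allowed T ->
      exists2 H, H \in K :: p & (ends e).1 \in fc_verts H
    & #|C :\: F0| < #|C :&: F0|].
Proof.
elim: p K a => [|L p IH] K a /=.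
  move=> _ _ /setIP[aK aA] /setIP[bK bB].
  have [P [bP _ PK cP]] := component_path aK bK aA bB.
  by exists P; split=> // e /PK eK _; exists K; rewrite ?mem_head.
case/andP=> /strict_stepP[e [b1 [a1 [el eN /setIP[b1K b1B] a1L]]]] Lp.
case/andP=> KLp Lp_uniq /setIP[aK aA] bLp.
have [C [bC CLp cC]] := IH L a1 Lp Lp_uniq a1L bLp.
have [P [bP PA PK cP]] := component_path aK b1K aA b1B.
have eF0 : e \notin F0 by apply: contra eN; apply/subsetP/min_join_allowed.
have eP : e \notin P by apply: contra eN; apply/subsetP.
exists (symdiff (symdiff P [set e]) C); split.
- move=> v; rewrite !bd_symdiff bP bC (bd1 bipartition_loopless _ el).
  by case: (v == a); case: (v == b1); case: (v == a1); case: (v == b).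
- move=> e' e'C e'A; case e'C2: (e' \in C).
    have [H HL e'H] := CLp e' e'C2 e'A; exists H => //.
    by rewrite in_cons HL orbT.
  move: e'C; rewrite !inE e'C2 addbF; case: eqP => [E|_].
    by rewrite -E e'A in eN.
  by rewrite addbF => /PK; exists K; rewrite ?mem_head.
have dis e' : e' \in P -> e' \in C -> False.
  move=> e'P e'C; have [H HL e'H] := CLp e' e'C (subsetP PA e' e'P).
  by move: KLp; rewrite (factor_component_eq (PK e' e'P) e'H) HL.
set S := symdiff _ C.
have in_F0 : #|S :&: F0| = #|P :&: F0| + #|C :&: F0|.
  rewrite -cardsUI; have -> : P :&: F0 :&: (C :&: F0) = set0.
    apply/setP=> e'; rewrite !inE; apply/negP=> /andP[/andP[h1 _] /andP[h2 _]].
    exact: dis h1 h2.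
  rewrite cards0 addn0; apply: eq_card => e'; rewrite !inE.
  case: eqP => [->|_]; first by rewrite (negPf eF0) !andbF.
  have := dis e'; case: (e' \in P); case: (e' \in C); case: (e' \in F0) => //.
  by move=> /(_ isT isT).
(* An upper bound is enough: if [e] also lay in [C], the cancellation would only lower the count. *)
have out_F0 : #|S :\: F0| <= #|P :\: F0| + 1 + #|C :\: F0|.
  have sub : S :\: F0 \subset (P :\: F0) :|: [set e] :|: (C :\: F0).
    apply/subsetP=> e'; rewrite !inE.
    by case: (e' \in P); case: (e' \in C); case: (e' \in F0); case: (e' == e).
  apply: leq_trans (subset_leq_card sub) _.
  apply: leq_trans (leq_card_setU _ _) _; rewrite leq_add2r -(cards1 e).
  exact: leq_card_setU.
move: in_F0 out_F0 cP cC; clear; lia.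
Qed.

(** The closing edge [e] completes the chain set to an even set. The surplus of the chain pays for
    [e], so switching [F0] gives a minimum join containing [e], although crossing edges are not
    allowed. *)
Lemma strict_step_acyclic K p : path strict_step K p -> uniq (K :: p) ->
  strict_step (last K p) K -> False.
Proof.
move=> Kp uKp /strict_stepP[e [b [a [el eN bL aK]]]].
have [C [bC _ cC]] := chain_path Kp uKp aK bL.
pose F := symdiff (symdiff F0 C) [set e].
have F_join : is_join T F.
  apply/is_joinP=> v; rewrite !bd_symdiff (min_join_bd F0_min) bC.
  rewrite (bd1 bipartition_loopless _ el).
  by case: (v \in T); case: (v == a); case: (v == b).
have eF0 : e \notin F0 by apply: contra eN; apply/subsetP/min_join_allowed.
have cFC : #|symdiff F0 C| < #|F0|.
  have := card_symdiff F0 C; have := cardsID F0 C; rewrite (setIC F0 C).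
  move: cC; clear; lia.
have F_le : #|F0| <= #|F| by apply: (min_join_le F0_min); apply/is_joinP.
have cF := card_symdiff1 (symdiff F0 C) e; rewrite -/F in cF.
(* Otherwise the last toggle would delete [e] and leave a join smaller than [F0]. *)
have eC : e \notin symdiff F0 C.
  by apply/negP=> eC; move: cF cFC F_le; rewrite eC; clear; lia.
case/negP: eN; rewrite inE; apply/existsP; exists F; apply/andP; split.
  rewrite /is_min_join F_join; apply/forallP=> F'; apply/implyP=> F'j.
  have : #|F0| <= #|F'| by apply: (min_join_le F0_min); apply/is_joinP.
  by move: cF cFC; rewrite (negPf eC); clear; lia.
by rewrite inE (negPf eC) inE eqxx.
Qed.

End MinJoin.

Lemma tri_le_connect H K : tri_le A B H K -> connect strict_step H K.
Proof.
case=> s; elim: s H => [|L s IH] H /=; first by move=> _ ->.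
case/andP=> HL Ls E; have [->|neHL] := eqVneq H L; first exact: IH.
by apply: connect_trans (IH L Ls E); apply: connect1; rewrite /strict_step /= neHL.
Qed.

Lemma strict_step_antisym H K :
  connect strict_step H K -> connect strict_step K H -> H = K.
Proof.
case/connectP=> [[|L p] /=]; first by move=> _ ->.
case/andP=> HL Lp -> LH.
have /connectP[q Lq HE] : connect strict_step L H.
  by apply: connect_trans LH; apply/connectP; exists p.
(* Shortening the return path from [L] to [H] makes its components distinct, as acyclicity
   requires. *)
case: (shortenP Lq) HE => q' Lq' uq' _ HE; exfalso.
rewrite HE in HL.
(* Without a minimum join the factor-components are single vertices. *)
have [F0 F0_min|no_join] := pickP (is_min_join T).
  exact: (strict_step_acyclic F0_min Lq' uq' HL).
have no_allowed : allowed T = set0.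
  by apply/setP=> e; rewrite !inE; apply/existsP=> -[F]; rewrite no_join.
have [_ [_ [a [_ _ _ /setIP[aL aA]]]]] := strict_stepP HL.
(* The cycle enters [L] at the spine vertex [a] and leaves it at a tooth vertex [b], so [L] has two
   vertices. *)
have [b /setIP[bL bB]] : exists b, b \in fc_verts L :&: B.
  case: q' Lq' HL {uq' HE} => [|M q'] /=.
    by rewrite /strict_step /= eqxx.
  by case/andP=> /strict_stepP[_ [b [_ [_ _ bL _]]]] _ _; exists b.
move: bL; rewrite (factor_component_connect _ aL) no_allowed.
case/connectP=> -[|c s] /=.
  by move=> _ E; rewrite E in bB; exact: bipartition_disjoint aA bB.
by case/andP=> /existsP[e]; rewrite inE.
Qed.

End BipartiteGrafts.

Theorem theorem6p5 (G : multigraph) (T A B : {set vert G})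
    (hcomb : comb_bipartite T A B) :
  [/\ (forall H : factor_component T, tri_le A B H H),
      (forall H1 H2 : factor_component T,
         tri_le A B H1 H2 -> tri_le A B H2 H1 -> H1 = H2)
    & (forall H1 H2 H3 : factor_component T,
         tri_le A B H1 H2 -> tri_le A B H2 H3 -> tri_le A B H1 H3)].
Proof.
have [_ AB _] := hcomb; split.
- by move=> H; exists [::].
- move=> H1 H2 /tri_le_connect H12 /tri_le_connect H21.
  exact: strict_step_antisym AB _ _ H12 H21.
move=> H1 H2 H3 [s p1 <-] [t p2 <-]; exists (s ++ t); last by rewrite last_cat.
by rewrite cat_path p1.
Qed.
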